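(* Let $X$ be a real Hilbert space and let $U_1,\ldots,U_m$ be closed linear subspaces of $X$. Then $$\operatorname{Fix}(R_{U_m}R_{U_{m-1}}\cdots R_{U_2}R_{U_1})=\operatorname{Fix}(R_{U_1}R_{U_2}\cdots R_{U_{m-1}}R_{U_m}).$$
   Context: For a closed linear subspace $U$ of $X$, $P_U$ denotes the orthogonal projector onto $U$, and $R_U:=2P_U-\operatorname{Id}$ is the corresponding reflector. For a map $T\colon X\to X$, $\operatorname{Fix} T=\{x\in X : Tx=x\}$. Juxtaposition of operators denotes composition. *)

(* Defs.v *)
From HB Require Import structures.
From mathcomp Require Import all_boot all_order all_algebra.
From mathcomp Require Import all_classical all_reals all_analysis.
Set Implicit Arguments.
Unset Strict Implicit.
Unset Printing Implicit Defensive.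
Import Order.TTheory GRing.Theory Num.Theory numFieldNormedType.Exports.
Local Open Scope classical_set_scope.
Local Open Scope ring_scope.

Definition closed_linear_subspace (R : realType) (X : normedModType R)
    (U : set X) : Prop :=
  submod_closed (mem U) /\ closed U.

(* The p in U with x - p orthogonal to U; for a closed subspace of a Hilbert
   space it exists and is unique, so the default value 0 of xget is not used. *)
Definition orth_proj (R : realType) (X : lmodType R) (dot : {dot X for idfun})
    (U : set X) (x : X) : X :=
  xget 0 [set p | U p /\ forall u, U u -> dot (x - p) u = 0].

Definition reflector (R : realType) (X : lmodType R) (dot : {dot X for idfun})
    (U : set X) (x : X) : X :=
  2 *: orth_proj dot U x - x.

Definition Fix (T : Type) (f : T -> T) : set T := [set x | f x = x].

(* Main.v *)
Require Import Defs.
From HB Require Import structures.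
From mathcomp Require Import all_boot all_order all_algebra.
From mathcomp Require Import all_classical all_reals all_analysis.
Set Implicit Arguments.
Unset Strict Implicit.
Unset Printing Implicit Defensive.
Import Order.TTheory GRing.Theory Num.Theory numFieldNormedType.Exports.
Local Open Scope classical_set_scope.
Local Open Scope ring_scope.

(** A reflector is its own inverse.  The point [R x = 2 P x - x] differs from
[P x] by [P x - x], which is orthogonal to the subspace just as [x - P x] is, so
[R x] has the same projection as [x] ([orth_proj_reflector]), and
[R (R x) = 2 P x - (2 P x - x) = x] ([reflectorK]).  Composing the same
involutions in the opposite order therefore gives the inverse map
([comp_rev_ordK]), and a bijection has the same fixed points as its inverse
([eq_Fix_can]). *)

Lemma eq_Fix_can (T : Type) (f g : T -> T) :
  cancel f g -> cancel g f -> Fix f = Fix g.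
Proof.
move=> fK gK; apply/seteqP; split=> x /= fix_x.
  by have := fK x; rewrite fix_x.
by have := gK x; rewrite fix_x.
Qed.

(** Splitting the last factor off an iterated composition uses associativity
and the unit laws, so composition is registered as a monoid law. *)
HB.instance Definition _ (T : Type) :=
  Monoid.isLaw.Build (T -> T) id (@comp T T T)
    (fun _ _ _ => erefl) (fun _ => erefl) (fun _ => erefl).

Lemma comp_rev_ordK (T : Type) (m : nat) (f : 'I_m -> T -> T) :
  (forall i, involutive (f i)) ->
  cancel (\big[comp/id]_(i < m) f i) (\big[comp/id]_(i < m) f (rev_ord i)).
Proof.
elim: m f => [|m IHm] f fK; first by rewrite !big_ord0.
(* The outermost factor [f ord0] on the one side meets itself as the innermost
   factor on the other. *)
rewrite big_ord_recl [X in cancel _ X]big_ord_recr => x /=.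
have -> : rev_ord ord_max = ord0 :> 'I_m.+1 by apply: val_inj; rewrite /= subnn.
rewrite fK.
under eq_bigr => i _.
  have -> : rev_ord (widen_ord (leqnSn m) i) = lift ord0 (rev_ord i).
    by apply: val_inj; rewrite /= /bump /= add1n -subSn.
  over.
by apply: (IHm (fun i => f (lift ord0 i))) => i; apply: fK.
Qed.

Lemma submod_setB (R : pzRingType) (X : lmodType R) (U : set X) (p q : X) :
  submod_closed (mem U) -> U p -> U q -> U (p - q).
Proof.
move=> [_ /(_ (-1) q p)]; rewrite !inE scaleN1r addrC => UB Up Uq.
exact: UB.
Qed.

Lemma submod_setN (R : pzRingType) (X : lmodType R) (U : set X) (p : X) :
  submod_closed (mem U) -> U p -> U (- p).
Proof.
move=> Usub Up; rewrite -sub0r; apply: (submod_setB Usub _ Up).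
by have [] := Usub; rewrite inE.
Qed.

(** The difference of two candidates lies in [U] and is orthogonal to [U],
hence to itself. *)
Lemma orth_proj_uniq (R : realType) (X : lmodType R) (dot : {dot X for idfun})
    (U : set X) (x : X) :
  submod_closed (mem U) ->
  is_subset1 [set p | U p /\ forall u, U u -> dot (x - p) u = 0].
Proof.
move=> Usub p q [Up xp] [Uq xq]; apply/eqP; rewrite -subr_eq0.
apply: contraT => /(neq0_dnorm_gt0 (s := dot)).
have Upq := submod_setB Usub Up Uq.
have -> : dot (p - q) (p - q) = 0.
  have {1}-> : p - q = (x - q) - (x - p) by rewrite opprB [RHS]addrC subrKA.
  by rewrite linearBl /= xq // xp // subrr.
by rewrite ltxx.
Qed.

(** If [p] is the projection of [x], then [(2 p - x) - p = - (x - p)] is still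
orthogonal to [U].  A point that has none gets the default value [0] and is
reflected to [- x], which has none either since [U] is closed under negation. *)
Lemma orth_proj_reflector (R : realType) (X : lmodType R)
    (dot : {dot X for idfun}) (U : set X) (x : X) :
  submod_closed (mem U) ->
  orth_proj dot U (reflector dot U x) = orth_proj dot U x.
Proof.
move=> Usub; have [[p [Up xp]]|no_foot] :=
  pselect (exists p, U p /\ forall u, U u -> dot (x - p) u = 0).
  have Px : orth_proj dot U x = p.
    by apply: xget_subset1; last exact: orth_proj_uniq.
  rewrite /reflector Px; apply: xget_subset1; last exact: orth_proj_uniq.
  split=> // u Uu.
  have -> : 2 *: p - x - p = - (x - p).
    by rewrite scaler_nat mulr2n addrAC addrK opprB.
  by rewrite linearNl /= xp // oppr0.
have Px : orth_proj dot U x = 0.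
  by apply: xgetPN => p foot; apply: no_foot; exists p.
rewrite /reflector Px scaler0 sub0r.
apply: xgetPN => p [Up xp]; apply: no_foot; exists (- p).
split=> [|u Uu]; first exact: submod_setN.
have -> : x - - p = - (- x - p) by rewrite opprD !opprK.
by rewrite linearNl /= xp // oppr0.
Qed.

Lemma reflectorK (R : realType) (X : lmodType R) (dot : {dot X for idfun})
    (U : set X) :
  submod_closed (mem U) -> involutive (reflector dot U).
Proof.
move=> Usub x.
by rewrite {1}/reflector orth_proj_reflector // /reflector subKr.
Qed.

(* X is a real Hilbert space: a complete normed space whose norm comes from the
   inner product dot.  U_1, ..., U_m are U 0, ..., U (m - 1), and
   \big[comp/id]_(i < m) F i is F 0 \o F 1 \o ... \o F (m - 1). *)
Theorem theorem2p6 (R : realType) (X : completeNormedModType R)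
    (dot : {dot X for idfun}) (dot_norm : forall x : X, dot x x = `|x| ^+ 2)
    (m : nat) (U : 'I_m -> set X)
    (HU : forall i : 'I_m, closed_linear_subspace (U i)) :
  Fix (\big[comp/id]_(i < m) reflector dot (U (rev_ord i))) =
  Fix (\big[comp/id]_(i < m) reflector dot (U i)).
Proof.
have refK i : involutive (reflector dot (U i)).
  by apply: reflectorK; have [] := HU i.
apply: eq_Fix_can; last exact: comp_rev_ordK.
have -> : \big[comp/id]_(i < m) reflector dot (U i) =
          \big[comp/id]_(i < m) reflector dot (U (rev_ord (rev_ord i))).
  by apply: eq_bigr => i _; rewrite rev_ordK.
exact: (comp_rev_ordK (f := fun i => reflector dot (U (rev_ord i)))).
Qed.
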